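(* Consider a matrix $A\in\mathbb{R}^{n\times n}$ (of a linear time-invariant system $\dot x = Ax + Bu$), an initial set $\mathcal{X}_0\subset\mathbb{R}^n$ given as a polynomial zonotope, a time step size $\Delta t$, and the set $\mathcal{H}([0,\Delta t]) = e^{A\boldsymbol{\mathcal{T}}}\,\mathcal{X}_0$, where $\boldsymbol{\mathcal{T}}=[0,\Delta t]\cdot I_n$. Fix an arbitrary error bound $\psi>0$. Then the number of Taylor terms $\kappa$ required to ensure that the over-approximation error for the enclosure of the set $\mathcal{H}([0,\Delta t]) = e^{A\boldsymbol{\mathcal{T}}}\,\mathcal{X}_0$, calculated with the truncated-Taylor-series enclosure of order $\kappa$ described in the context, stays below $\psi$ only grows linearly with respect to the time step size $\Delta t$.
   Context: Zonotope: $\{c+\sum_{i=1}^h \alpha_i G_{(\,,i)} \mid \alpha_i\in[-1,1]\}$ with $c\in\mathbb{R}^n$, $G\in\mathbb{R}^{n\times h}$, where $G_{(\,,i)}$ is the $i$-th column. Polynomial zonotope: $\langle c,G,G_I,E,id\rangle_{PZ}=\{c+\sum_{i=1}^h(\prod_{k=1}^p\alpha_k^{E_{(k,i)}})G_{(\,,i)}+\sum_{j=1}^q\beta_jG_{I(\,,j)}\mid\alpha_k,\beta_j\in[-1,1]\}$ with $c\in\mathbb{R}^n$, $G\in\mathbb{R}^{n\times h}$, $G_I\in\mathbb{R}^{n\times q}$, $E\in\mathbb{N}_0^{p\times h}$, and $id\in\mathbb{N}^p$ a list of distinct identifiers of the factors $\alpha_k$. Matrix zonotope: $\langle A^{(0)},A^{(1)},\dots,A^{(w)},id\rangle_{MZ}=\{A^{(0)}+\sum_{l=1}^w\rho_lA^{(l)}\mid\rho_l\in[-1,1]\}$,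 with $id$ identifying the factors $\rho_l$. Time is represented by the matrix zonotope $\boldsymbol{\mathcal{T}}=[0,\Delta t]\cdot I_n=\langle T,T,id_t\rangle_{MZ}$, $T=0.5\,\Delta t\,I_n$, with a new unique identifier $id_t$; so $\|\boldsymbol{\mathcal{T}}\|_\infty=\Delta t$, where $\|\cdot\|_\infty$ of a matrix set is the maximum of the infinity norms of its elements. The set to be enclosed is $e^{A\boldsymbol{\mathcal{T}}}\mathcal{X}_0=\{e^{At}x\mid t\in[0,\Delta t],\,x\in\mathcal{X}_0\}$. Enclosure: for a Taylor order $\kappa$ satisfying $\epsilon=\frac{\|A\|_\infty\Delta t}{\kappa+2}<1$, $$e^{A\boldsymbol{\mathcal{T}}}\,\mathcal{X}_0\subseteq\Big(\boxplus_{i=0}^{\kappa}\frac{A^i\boldsymbol{\mathcal{T}}^i}{i!}\,\mathcal{X}_0\Big)\oplus\Big(\boldsymbol{\mathcal{E}}\ \mathrm{zonotope}(\mathcal{X}_0)\Big),$$ where $\boldsymbol{\mathcal{E}}$ is the interval matrix (a set of matrices given by entrywise intervals) all of whose entries are the interval $[-1,1]\cdot\frac{(\|A\|_\infty\Delta t)^{\kappa+1}}{(\kappa+1)!}\frac{1}{1-\epsilon}$; it encloses the remaining terms of the Taylor series. Here $\oplus$ is the Minkowski sum; $\boxplus$ is the exact sum, which adds two polynomial zonotopes while treating factors with equal identifiers as one and the same factor (so that dependencies, in particular on time, are kept); products with powers of $A$ and $\boldsymbol{\mathcal{T}}$ are computed by repeated multiplication of a polynomial zonotope with a matrix zonotope,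 again keeping factors with equal identifiers identical; $\mathrm{zonotope}(\mathcal{X}_0)$ is a tight zonotope enclosing $\mathcal{X}_0$; and the product of an interval matrix with a zonotope is computed by a known method for multiplying interval matrices with zonotopes. The first summand is evaluated exactly using the exact sum, so the over-approximation error of the enclosure is given by the second summand $\boldsymbol{\mathcal{E}}\ \mathrm{zonotope}(\mathcal{X}_0)$; no particular metric for this error is fixed. *)

(* Defs.v *)
From HB Require Import structures.
From mathcomp Require Export all_boot all_order all_algebra.
From mathcomp Require Export all_classical all_reals all_analysis.
Set Implicit Arguments.
Unset Strict Implicit.
Unset Printing Implicit Defensive.
Import Order.TTheory GRing.Theory Num.Theory.
Import numFieldNormedType.Exports.
Local Open Scope classical_set_scope.
Local Open Scope ring_scope.

Section matrices.
Context {R : realType}.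

Definition infnorm m n (A : 'M[R]_(m, n)) : R :=
  \big[Num.max/0]_(i < m) \sum_(j < n) `|A i j|.

Definition expmx n (A : 'M[R]_n) : 'M[R]_n :=
  limn (series (fun k => (k`!%:R)^-1 *: A ^+ k)).

Definition is_norm n (N : 'cV[R]_n -> R) : Prop :=
  [/\ forall x, N x = 0 -> x = 0,
      forall (a : R) x, N (a *: x) = `|a| * N x
    & forall x y, N (x + y) <= N x + N y].

Definition minkowski_sum n (X Y : set 'cV[R]_n) : set 'cV[R]_n :=
  [set x + y | x in X & y in Y].

End matrices.

Section zonotopes.
Context {R : realType}.

Record zonotope (n : nat) := Zonotope {
  zono_ngens : nat;
  zono_center : 'cV[R]_n;
  zono_gens : 'M[R]_(n, zono_ngens) }.

Definition zono_set n (Z : zonotope n) : set 'cV[R]_n :=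
  [set zono_center Z + \sum_i a i *: col i (zono_gens Z)
     | a in [set a : 'I_(zono_ngens Z) -> R | forall i, -1 <= a i <= 1]].

Record interval_matrix (m n : nat) := IntervalMatrix {
  imx_lower : 'M[R]_(m, n);
  imx_upper : 'M[R]_(m, n) }.

Definition imx_mid m n (M : interval_matrix m n) : 'M[R]_(m, n) :=
  2^-1 *: (imx_lower M + imx_upper M).

Definition imx_rad m n (M : interval_matrix m n) : 'M[R]_(m, n) :=
  2^-1 *: (imx_upper M - imx_lower M).

(* Althoff's product of an interval matrix with a zonotope: writing the matrix
   as C + [-S, S] and the zonotope as (c, G), the result has center C c, the
   generators C G, and one axis-aligned generator per coordinate whose length
   is the corresponding entry of S (|c| + sum_i |G_i|). *)
Definition imx_zono_mul m n (M : interval_matrix m n) (Z : zonotope n) :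
    zonotope m :=
  let absZ : 'cV[R]_n :=
    \col_k (`|zono_center Z k 0| + \sum_i `|zono_gens Z k i|) in
  Zonotope (imx_mid M *m zono_center Z)
           (row_mx (imx_mid M *m zono_gens Z)
                   (diag_mx (imx_rad M *m absZ)^T)).

End zonotopes.
Arguments zonotope : clear implicits.
Arguments interval_matrix : clear implicits.

Section polynomial_zonotopes.
Context {R : realType}.

(* Factors are named globally: [inl k] is the factor with identifier k, and
   [inr j] is the j-th independent factor beta_j. *)
Definition factor : Type := (nat + nat)%type.

Definition valuation : set (factor -> R) :=
  [set v | forall f, -1 <= v f <= 1].

(* A factor-parametrised vector.  All set operations that must keep track of
   shared factors are performed at this level, before taking the range. *)
Definition factor_map (n : nat) : Type := (factor -> R) -> 'cV[R]_n.

Definition factor_range n (F : factor_map n) : set 'cV[R]_n := F @` valuation.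

Record polyzonotope (n : nat) := PolyZonotope {
  pz_h : nat;
  pz_q : nat;
  pz_p : nat;
  pz_center : 'cV[R]_n;
  pz_gens : 'M[R]_(n, pz_h);
  pz_indep : 'M[R]_(n, pz_q);
  pz_expo : 'M[nat]_(pz_p, pz_h);
  pz_ids : pz_p.-tuple nat;
  pz_ids_uniq : uniq pz_ids }.

Definition pz_eval n (X : polyzonotope n) : factor_map n := fun v =>
  pz_center X
  + \sum_i (\prod_k v (inl (tnth (pz_ids X) k)) ^+ pz_expo X k i)
             *: col i (pz_gens X)
  + \sum_(j < pz_q X) v (inr (nat_of_ord j)) *: col j (pz_indep X).

Definition pz_set n (X : polyzonotope n) : set 'cV[R]_n :=
  factor_range (pz_eval X).

Record matzonotope (m n : nat) := MatZonotope {
  mz_w : nat;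
  mz_center : 'M[R]_(m, n);
  mz_gens : 'I_mz_w -> 'M[R]_(m, n);
  mz_ids : mz_w.-tuple nat;
  mz_ids_uniq : uniq mz_ids }.

Definition mz_eval m n (M : matzonotope m n) (v : factor -> R) : 'M[R]_(m, n) :=
  mz_center M + \sum_l v (inl (tnth (mz_ids M) l)) *: mz_gens l.

Definition mz_mul m n (M : matzonotope m n) (F : factor_map n) : factor_map m :=
  fun v => mz_eval M v *m F v.

Definition mx_map m n (A : 'M[R]_(m, n)) (F : factor_map n) : factor_map m :=
  fun v => A *m F v.

Definition exact_sum n k (F : 'I_k -> factor_map n) : factor_map n :=
  fun v => \sum_i F i v.

Definition time_mz n (dt : R) (idt : nat) : matzonotope n n :=
  let T : 'M[R]_n := (2^-1 * dt)%:M in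
  @MatZonotope n n 1 T (fun=> T) [tuple idt] isT.

End polynomial_zonotopes.
Arguments polyzonotope : clear implicits.
Arguments matzonotope : clear implicits.
Arguments factor_map : clear implicits.

Section enclosure.
Context {R : realType} {n : nat}.
Variables (A : 'M[R]_n) (dt : R).

Definition reach_set (X : set 'cV[R]_n) : set 'cV[R]_n :=
  [set expmx (t *: A) *m x | t in `[0, dt] & x in X].

Definition taylor_eps (kappa : nat) : R := infnorm A * dt / kappa.+2%:R.

Definition taylor_term (X : polyzonotope R n) (idt i : nat) : factor_map R n :=
  mx_map ((i`!%:R)^-1 *: A ^+ i)
         (iter i (mz_mul (time_mz n dt idt)) (pz_eval X)).

Definition taylor_main (X : polyzonotope R n) (idt kappa : nat) :
    set 'cV[R]_n :=
  factor_range (exact_sum (fun i : 'I_kappa.+1 => taylor_term X idt i)).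

Definition taylor_remainder_mx (kappa : nat) : interval_matrix R n n :=
  let r := (infnorm A * dt) ^+ kappa.+1 / (kappa.+1)`!%:R
           * (1 / (1 - taylor_eps kappa)) in
  IntervalMatrix (const_mx (- r)) (const_mx r).

(* [Z] is the zonotope enclosure of the initial set. *)
Definition taylor_remainder (Z : zonotope R n) (kappa : nat) : zonotope R n :=
  imx_zono_mul (taylor_remainder_mx kappa) Z.

Definition taylor_enclosure (X : polyzonotope R n) (idt : nat)
    (Z : zonotope R n) (kappa : nat) : set 'cV[R]_n :=
  minkowski_sum (taylor_main X idt kappa)
                (zono_set (taylor_remainder Z kappa)).

(* The first summand of the enclosure is evaluated exactly, so the error is
   the size of the second summand, measured in the norm [N]. *)
Definition overapprox_error (N : 'cV[R]_n -> R) (Z : zonotope R n)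
    (kappa : nat) : \bar R :=
  ereal_sup [set (N z)%:E | z in zono_set (taylor_remainder Z kappa)].

Definition sufficient_order (N : 'cV[R]_n -> R) (X : polyzonotope R n)
    (idt : nat) (Z : zonotope R n) (psi : R) (kappa : nat) : Prop :=
  [/\ taylor_eps kappa < 1,
      reach_set (pz_set X) `<=` taylor_enclosure X idt Z kappa
    & (overapprox_error N Z kappa < psi%:E)%E].

End enclosure.

(* Main.v *)
(* Entrywise, the tail of the Taylor series of [expmx (t *: A)] is dominated by
   the tail of [exp a] with [a = infnorm A * dt], hence by a geometric series of
   sum at most [r = a^(k+1)/(k+1)! / (1 - eps)].  The remainder zonotope is a
   cube whose half-width is [r] times a constant of [Z0], so the enclosure holds
   as soon as [eps < 1], and the error is at most [r K] with [K] depending only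
   on [Z0] and [N].  Since [a^m/m! <= exp (e a - m)], an order [k] with
   [k + 1 >= (e + 2) a + 2 K / psi] is sufficient; this is linear in [dt]. *)
Require Import Defs.
From mathcomp Require Import ring lra.
Set Implicit Arguments.
Unset Strict Implicit.
Unset Printing Implicit Defensive.
Import Order.TTheory GRing.Theory Num.Theory.
Import numFieldNormedType.Exports.
Local Open Scope classical_set_scope.
Local Open Scope ring_scope.

(** * The Taylor tail of the matrix exponential, entry by entry *)

Section matrix_exponential.
Context {R : realType}.

Lemma infnorm_ge0 m n (A : 'M[R]_(m, n)) : 0 <= infnorm A.
Proof. exact: bigmax_ge_id. Qed.

Lemma row_sum_le_infnorm m n (A : 'M[R]_(m, n)) i :
  \sum_j `|A i j| <= infnorm A.
Proof. exact: (le_bigmax _ (fun i => \sum_j `|A i j|)). Qed.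

(* [exprZn] needs a nontrivial ring, which ['M_n] is not when [n = 0]. *)
Lemma exprZmx n (t : R) (A : 'M[R]_n) k : (t *: A) ^+ k = t ^+ k *: A ^+ k.
Proof.
elim: k => [|k IH]; first by rewrite !expr0 scale1r.
by rewrite !exprS IH -[RHS]scalerA /GRing.mul/= -scalemxAl -scalemxAr.
Qed.

Lemma expr_entry_le n (A : 'M[R]_n) k i j :
  `|(A ^+ k) i j| <= infnorm A ^+ k.
Proof.
elim: k i j => [|k IH] i j.
  by rewrite !expr0 mxE; case: eqP => _; rewrite ?normr1 ?normr0.
rewrite !exprS mxE (le_trans (ler_norm_sum _ _ _)) //.
apply: (le_trans _ (ler_wpM2r (exprn_ge0 k (infnorm_ge0 A))
                              (row_sum_le_infnorm A i))).
rewrite mulr_suml ler_sum // => l _.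
by rewrite normrM ler_wpM2l.
Qed.

(** A basic neighbourhood constrains only finitely many entries, so the entrywise conditions
    eventually hold together. *)
Lemma cvg_matrix (T : Type) (F : set_system T) {FF : Filter F} m n
    (f : T -> 'M[R]_(m, n)) (L : 'M[R]_(m, n)) :
  (forall i j, f t i j @[t --> F] --> L i j) -> f t @[t --> F] --> L.
Proof.
move=> fL U [P LP PU]; rewrite /nbhs /=.
have : \forall t \near F, forall i j, P i j (f t i j).
  apply: filter_forall => i; apply: filter_forall => j.
  exact: fL (LP i j).
by apply: filterS => t Pt; apply: PU.
Qed.

Lemma geometric_sum_le (q : R) J : 0 <= q -> q < 1 ->
  \sum_(i < J) q ^+ i <= 1 / (1 - q).
Proof.
move=> q0 q1; rewrite ler_pdivlMr ?subr_gt0//.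
have := subrX1 q J; have := exprn_ge0 J q0; nra.
Qed.

(** From index [m] on, the ratio of consecutive terms is [a / (m + j).+1%:R], hence at most
    [a / m.+1%:R]. *)
Lemma exp_coeff_geometric (a : R) m j : 0 <= a ->
  exp_coeff a (m + j)%N <= exp_coeff a m * (a / m.+1%:R) ^+ j.
Proof.
move=> a0; elim: j => [|j IH]; first by rewrite addn0 expr0 mulr1.
have -> : exp_coeff a (m + j.+1)%N =
    exp_coeff a (m + j)%N * (a / (m + j).+1%:R).
  by rewrite /exp_coeff/= addnS exprSr factS natrM invfM; ring.
rewrite exprSr [leRHS]mulrA ler_pM ?exp_coeff_ge0 ?divr_ge0//.
by rewrite ler_wpM2l// lef_pV2 ?posrE// ler_nat ltnS leq_addr.
Qed.

(** For [m = k.+1] and [a = infnorm A * dt], the ratio is [taylor_eps] and the bound is the entry of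
    [taylor_remainder_mx]. *)
Lemma exp_tail_le (a : R) m N : 0 <= a -> a / m.+1%:R < 1 ->
  \sum_(m <= i < N) exp_coeff a i
    <= a ^+ m / m`!%:R * (1 / (1 - a / m.+1%:R)).
Proof.
move=> a0 a1; rewrite -{1}(add0n m) big_addn big_mkord.
apply: (@le_trans _ _ (\sum_(i < N - m) exp_coeff a m * (a / m.+1%:R) ^+ i)).
  by apply: ler_sum => i _; rewrite addnC exp_coeff_geometric.
rewrite -mulr_sumr ler_wpM2l ?exp_coeff_ge0//.
by rewrite geometric_sum_le// divr_ge0.
Qed.

Lemma exp_term_entry_le n (A : 'M[R]_n) (a t : R) k p q :
  0 <= t -> infnorm A * t <= a ->
  `|((k`!%:R)^-1 *: (t *: A) ^+ k) p q| <= exp_coeff a k.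
Proof.
move=> t0 ta; rewrite exprZmx !mxE !normrM
  (ger0_norm (exprn_ge0 _ t0)) ger0_norm ?invr_ge0//.
rewrite /exp_coeff/= mulrC ler_wpM2r ?invr_ge0//.
rewrite (le_trans (ler_wpM2l (exprn_ge0 k t0) (expr_entry_le A k p q)))//.
by rewrite -exprMn lerXn2r ?nnegrE// ?(le_trans _ ta)// 1?mulrC//
  mulr_ge0 ?infnorm_ge0.
Qed.

(** [expmx] is a [limn], which says nothing without convergence. Each entry converges by comparison
    with the real exponential series at [infnorm A]. *)
Lemma expmx_cvg n (A : 'M[R]_n) :
  series (fun k => (k`!%:R)^-1 *: A ^+ k) @ \oo --> expmx A.
Proof.
suff [L hL] : exists L : 'M[R]_n,
    series (fun k => (k`!%:R)^-1 *: A ^+ k) @ \oo --> L.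
  exact: (cvgP L hL).
have h p q : cvgn (series (fun k => ((k`!%:R)^-1 *: A ^+ k) p q)).
  apply: normed_cvg; apply: (@series_le_cvg _ _ (exp_coeff (infnorm A))).
  - by move=> k; exact: normr_ge0.
  - by move=> k; rewrite exp_coeff_ge0 ?infnorm_ge0.
  - move=> k /=; have := @exp_term_entry_le n A (infnorm A) 1 k p q.
    by rewrite scale1r mulr1; apply.
  - exact: is_cvg_series_exp_coeff.
exists (\matrix_(p, q) limn (series (fun k => ((k`!%:R)^-1 *: A ^+ k) p q))).
apply: cvg_matrix => p q; rewrite mxE.
have -> : (fun N => series (fun k => (k`!%:R)^-1 *: A ^+ k) N p q) =
    series (fun k => ((k`!%:R)^-1 *: A ^+ k) p q).
  by apply/funext => N; rewrite /series /= summxE.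
exact: h.
Qed.

(** The tail bound is uniform in the length of the partial sums, so it passes to the limit. *)
Lemma expmx_remainder_le n (A : 'M[R]_n) (a t : R) m p q :
  0 <= t -> infnorm A * t <= a -> a / m.+1%:R < 1 ->
  `|(expmx (t *: A) - \sum_(i < m) (i`!%:R)^-1 *: (t *: A) ^+ i) p q|
    <= a ^+ m / m`!%:R * (1 / (1 - a / m.+1%:R)).
Proof.
move=> t0 ta a1.
have a0 : 0 <= a by rewrite (le_trans _ ta)// mulr_ge0 ?infnorm_ge0.
set u := fun k => (k`!%:R)^-1 *: (t *: A) ^+ k.
set P := \sum_(i < m) _.
set r := (X in _ <= X).
have cv : `|(series u N - P) p q| @[N --> \oo] --> `|(expmx (t *: A) - P) p q|.
  apply: cvg_norm; apply: (@cvg_comp _ _ _ (fun N => series u N - P)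
    (fun M : 'M[R]_n => M p q)); last exact: coord_continuous.
  by apply: cvgB; [exact: expmx_cvg|exact: cvg_cst].
rewrite -(cvg_lim _ cv)//; apply: limr_le; first exact: (cvgP _ cv).
exists m => // N /= mN.
have -> : series u N - P = \sum_(m <= i < N) u i.
  by rewrite -sub_series_geq// /series/= [in RHS]big_mkord; congr (_ - _);
    rewrite big_mkord.
rewrite summxE (le_trans (ler_norm_sum _ _ _))//.
apply: (le_trans _ (exp_tail_le N a0 a1)); apply: ler_sum => i _.
exact: exp_term_entry_le.
Qed.

End matrix_exponential.

(** * The remainder zonotope as a cube *)

Section enclosure.
Context {R : realType} {n : nat}.
Implicit Types (A : 'M[R]_n) (Z : zonotope R n) (N : 'cV[R]_n -> R).

(** Entry [k] of the local vector [absZ] in [imx_zono_mul]. *)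
Definition zono_mag Z k : R :=
  `|zono_center Z k 0| + \sum_i `|zono_gens Z k i|.

Lemma zono_mag_ge0 Z k : 0 <= zono_mag Z k.
Proof. by rewrite addr_ge0 ?sumr_ge0. Qed.

Lemma zono_set_entry_le Z x k : zono_set Z x -> `|x k 0| <= zono_mag Z k.
Proof.
move=> [a ha <-]; rewrite mxE summxE (le_trans (ler_normD _ _))// lerD2l.
rewrite (le_trans (ler_norm_sum _ _ _))// ler_sum// => i _.
by rewrite !mxE normrM ler_piMl// ler_norml ha.
Qed.

Definition remainder_bound A (dt : R) k : R :=
  (infnorm A * dt) ^+ k.+1 / (k.+1)`!%:R * (1 / (1 - taylor_eps A dt k)).

Lemma remainder_bound_ge0 A dt k : 0 <= dt -> taylor_eps A dt k < 1 ->
  0 <= remainder_bound A dt k.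
Proof.
move=> dt0 e1; rewrite mulr_ge0// ?divr_ge0 ?exprn_ge0 ?mulr_ge0 ?infnorm_ge0//.
by rewrite subr_ge0 ltW.
Qed.

(** The interval matrix has midpoint 0 and constant radius, so the center and the first generators
    vanish, and the axis-aligned generators all have the same length [d]. *)
Lemma zono_set_taylor_remainder A dt Z k :
  0 <= remainder_bound A dt k ->
  zono_set (taylor_remainder A dt Z k) =
  [set z | forall i, `|z i 0| <= remainder_bound A dt k * \sum_l zono_mag Z l].
Proof.
set r := remainder_bound A dt k => r0.
set d := r * _.
have d0 : 0 <= d by rewrite mulr_ge0 ?sumr_ge0// => l _; exact: zono_mag_ge0.
have mid0 : imx_mid (taylor_remainder_mx A dt k) = 0.
  by apply/matrixP => i j; rewrite !mxE addNr mulr0.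
have entry (a : 'I_(zono_ngens Z + n) -> R) i :
    (zono_center (taylor_remainder A dt Z k) +
     \sum_j a j *: col j (zono_gens (taylor_remainder A dt Z k))) i 0
    = a (rshift _ i) * d.
  rewrite /taylor_remainder/= mid0 !mul0mx add0r big_split_ord/= mxE !summxE.
  rewrite big1 ?add0r => [|j _]; last first.
    by rewrite mxE [X in _ * X]mxE row_mxEl mxE mulr0.
  rewrite (bigD1 i)//= big1 ?addr0 => [|j ji]; last first.
    by rewrite mxE [X in _ * X]mxE row_mxEr !mxE eq_sym (negbTE ji)
      mulr0n mulr0.
  rewrite mxE [X in _ * X]mxE row_mxEr !mxE eqxx mulr1n; congr (_ * _).
  rewrite /d mulr_sumr; apply: eq_bigr => l _.
  by rewrite !mxE -/r opprK -mulr2n -[r *+ 2]mulr_natl mulrA mulVf// mul1r.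
apply/seteqP; split => [_ [a ha <-] i|z hz].
  rewrite entry normrM (ger0_norm d0) ler_piMl// ler_norml.
  exact: ha.
(* Only the axis-aligned generators get a coefficient. If [d = 0], the quotient is 0 by convention,
   and [z] is 0 as well. *)
exists (fun j : 'I_(zono_ngens Z + n) =>
  if fintype.split j is inr i then z i 0 / d else 0) => [j /=|].
  case: fintype.split => [_|i]; first by rewrite lerN10 ler01.
  rewrite -ler_norml normrM normfV (ger0_norm d0).
  have [->|dn0] := eqVneq d 0; first by rewrite invr0 mulr0 ler01.
  by rewrite ler_pdivrMr ?mul1r ?hz// lt_def dn0.
apply/colP => i; rewrite entry.
have -> : fintype.split (rshift (zono_ngens Z) i) = inr i.
  exact: (unsplitK (inr i)).
have [dd|dn0] := eqVneq d 0; last by rewrite divfK.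
by rewrite dd mulr0; apply/esym/eqP; rewrite -normr_le0 -dd hz.
Qed.

(** * Containment of the reachable set *)

Lemma taylor_main_mem A (dt t : R) (X : polyzonotope R n) idt v k :
  idt \notin pz_ids X -> 0 < dt -> 0 <= t <= dt -> valuation v ->
  taylor_main A dt X idt k
    ((\sum_(i < k.+1) (i`!%:R)^-1 *: (t *: A) ^+ i) *m pz_eval X v).
Proof.
move=> hidt dt0 /andP[t0 tdt] hv.
(* As [idt] is fresh, its factor can be reset without changing [pz_eval X]. The value [rho] chosen
   solves [dt / 2 + rho * (dt / 2) = t], and all powers of time share it. *)
pose w f : R := if f == inl idt then 2 * t / dt - 1 else v f.
have tdt1 : 0 <= t / dt <= 1.
  by rewrite divr_ge0 ?(ltW dt0)// ler_pdivrMr// mul1r.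
exists w.
  move=> f; rewrite /w; case: ifP => _; last exact: hv.
  by rewrite -mulrA; move: tdt1; lra.
have ew : pz_eval X w = pz_eval X v.
  rewrite /pz_eval; congr (_ + _ + _); apply: eq_bigr => i _.
  congr (_ *: _); apply: eq_bigr => j _; congr (_ ^+ _).
  rewrite /w; case: eqP => // -[e]; move: hidt; rewrite -e.
  by rewrite mem_tnth.
have et : mz_eval (time_mz n dt idt) w = t%:M.
  rewrite /mz_eval/= big_ord1 (tnth_nth 0%N)/= /w eqxx -[X in X + _]scale1r.
  rewrite -scalerDl addrC subrK scale_scalar_mx; congr (_%:M).
  by field; rewrite gt_eqF.
have eit i : iter i (mz_mul (time_mz n dt idt)) (pz_eval X) w
    = t ^+ i *: pz_eval X v.
  elim: i => [|i IH]; first by rewrite expr0 scale1r.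
  by rewrite iterS {1}/mz_mul IH et mul_scalar_mx scalerA exprS.
rewrite /exact_sum mulmx_suml; apply: eq_bigr => i _.
by rewrite /taylor_term /mx_map eit exprZmx -!scalemxAl -scalemxAr.
Qed.

(** Split [expmx (t *: A)] into its Taylor polynomial and the rest: the polynomial part lies in the
    exact sum, and the rest maps points of [Z] into the cube. *)
Lemma reach_set_sub_enclosure A (dt : R) (X : polyzonotope R n) Z idt k :
  pz_set X `<=` zono_set Z -> idt \notin pz_ids X ->
  0 < dt -> taylor_eps A dt k < 1 ->
  reach_set A dt (pz_set X) `<=` taylor_enclosure A dt X idt Z k.
Proof.
move=> XZ hidt dt0 e1 _ [t t0dt [_ [v hv <-]] <-].
have {}t0dt : 0 <= t <= dt by move: t0dt; rewrite /= in_itv.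
have t0 : 0 <= t by case/andP: t0dt.
have tdt : t <= dt by case/andP: t0dt.
set P := \sum_(i < k.+1) (i`!%:R)^-1 *: (t *: A) ^+ i.
exists (P *m pz_eval X v); first exact: taylor_main_mem.
exists ((expmx (t *: A) - P) *m pz_eval X v); last first.
  by rewrite mulmxBl addrC subrK.
rewrite zono_set_taylor_remainder ?remainder_bound_ge0 ?ltW// => i.
rewrite mxE mulr_sumr (le_trans (ler_norm_sum _ _ _))// ler_sum// => l _.
rewrite normrM ler_pM//.
  by apply: expmx_remainder_le => //; rewrite ler_wpM2l ?infnorm_ge0.
by apply/zono_set_entry_le/XZ; exists v.
Qed.

(** * The size of the remainder in an arbitrary norm *)

Lemma is_norm_ge0 N x : is_norm N -> 0 <= N x.
Proof.
(* Nonnegativity is not an axiom of [is_norm]; it follows from [0 = N (x - x) <= 2 * N x]. *)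
move=> [_ hZ hD]; have := hD x (- x); rewrite subrr.
have -> : N 0 = 0 by rewrite -(scale0r (0 : 'cV[R]_n)) hZ normr0 mul0r.
by rewrite -scaleN1r hZ normrN1 mul1r; lra.
Qed.

Lemma is_norm_sum_le N (I : Type) (s : seq I) (F : I -> 'cV[R]_n) :
  is_norm N -> N (\sum_(i <- s) F i) <= \sum_(i <- s) N (F i).
Proof.
move=> [_ hZ hD]; elim/big_ind2: _ => // [|x a y b xa yb].
  by rewrite -(scale0r (0 : 'cV[R]_n)) hZ normr0 mul0r.
by rewrite (le_trans (hD _ _))// lerD.
Qed.

Lemma is_norm_box_le N d (z : 'cV[R]_n) :
  is_norm N -> (forall i, `|z i 0| <= d) ->
  N z <= d * \sum_i N (delta_mx i 0).
Proof.
move=> hN hz; rewrite [z in N z]matrix_sum_delta mulr_sumr.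
rewrite (le_trans (is_norm_sum_le _ _ hN))// ler_sum// => i _.
rewrite big_ord1; have [_ -> _] := hN.
by rewrite ler_wpM2r ?is_norm_ge0.
Qed.

Lemma overapprox_error_le A dt N Z k : is_norm N ->
  0 <= remainder_bound A dt k ->
  (overapprox_error A dt N Z k <=
    (remainder_bound A dt k *
     ((\sum_l zono_mag Z l) * \sum_i N (delta_mx i 0)))%:E)%E.
Proof.
move=> hN r0; apply: ge_ereal_sup => _ [z hz <-]; rewrite lee_fin mulrA.
apply: is_norm_box_le => //.
by move: hz; rewrite zono_set_taylor_remainder.
Qed.

(** * An order linear in the time step that makes the remainder small *)

Lemma exp_coeff_le_expR (x : R) m : 0 <= x -> exp_coeff x m <= expR x.
Proof.
move=> x0; case: m => [|m].
  rewrite /exp_coeff/= expr0 fact0 invr1 mulr1.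
  by rewrite (le_trans _ (expR_ge1Dx x))// lerDl.
by rewrite (le_trans _ (expR_ge1Dxn m x0))// lerDr.
Qed.

(* Bound the [m]-th term of the series of [exp] at [e a]. *)
Lemma exp_coeff_le_expRB (a : R) m : 0 <= a ->
  exp_coeff a m <= expR (expR 1 * a - m%:R).
Proof.
move=> a0; rewrite expRD expRN ler_pdivlMr ?expR_gt0//.
rewrite -[m%:R]mulr1 expRM_natl.
have := @exp_coeff_le_expR (expR 1 * a) m (mulr_ge0 (expR_ge0 _) a0).
by rewrite /exp_coeff/= exprMn; apply: le_trans; rewrite mulrC mulrA.
Qed.

(** With [a = infnorm A * dt], the part [2 * a] of the threshold forces [taylor_eps] below 1/2,
    [expR 1 * a] cancels the growth in [exp_coeff_le_expRB], and [2 * c] leaves the factor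
    [expR (- (2 * c))]. *)
Lemma remainder_bound_small A (dt c : R) k : 0 <= dt -> 0 <= c ->
  (expR 1 + 2) * (infnorm A * dt) + 2 * c <= k.+1%:R ->
  taylor_eps A dt k < 1 /\ remainder_bound A dt k * c < 1.
Proof.
move=> dt0 c0; have a0 : 0 <= infnorm A * dt by rewrite mulr_ge0 ?infnorm_ge0.
rewrite /remainder_bound /taylor_eps.
move: (_ * dt) a0 => a a0; rewrite mulrDl => hk.
have ea0 : 0 <= expR 1 * a by rewrite mulr_ge0 ?expR_ge0.
have half : a / k.+2%:R <= 2^-1.
  by rewrite ler_pdivrMr// -[k.+2]addn1 natrD; move: hk ea0 c0; lra.
move: (a / k.+2%:R) half => eps half.
split; first by move: half; lra.
have inv2 : 1 / (1 - eps) <= 2.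
  by rewrite ler_pdivrMr; move: half; lra.
have coef : exp_coeff a k.+1 <= expR (- (2 * c)).
  rewrite (le_trans (exp_coeff_le_expRB _ a0))// ler_expR.
  by move: hk a0; lra.
have : a ^+ k.+1 / (k.+1)`!%:R * (1 / (1 - eps))
    <= expR (- (2 * c)) * 2.
  rewrite ler_pM// ?divr_ge0 ?exprn_ge0//.
  by move: half; lra.
move/(ler_wpM2r c0)/le_lt_trans; apply.
(* What remains is [2 * c < expR (2 * c)], a consequence of [1 + x <= expR x]. *)
rewrite -mulrA mulrC expRN ltr_pdivrMr ?expR_gt0// mul1r.
by rewrite (lt_le_trans _ (expR_ge1Dx _))// ltrDr.
Qed.

End enclosure.

Theorem lemma1 (R : realType) (n : nat) (A : 'M[R]_n)
    (X0 : polyzonotope R n) (Z0 : zonotope R n)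
    (hZ0 : pz_set X0 `<=` zono_set Z0)
    (idt : nat) (hidt : idt \notin pz_ids X0)
    (N : 'cV[R]_n -> R) (hN : is_norm N)
    (psi : R) (hpsi : 0 < psi) :
  exists a b : R, forall dt : R, 0 < dt ->
    exists kappa : nat,
      [/\ sufficient_order A dt N X0 idt Z0 psi kappa,
          forall k : nat, sufficient_order A dt N X0 idt Z0 psi k ->
            (kappa <= k)%N
        & kappa%:R <= a * dt + b].
Proof.
(* [K] is chosen before [dt], so the slope and the intercept built from it are uniform in the time
   step. *)
pose K := (\sum_l zono_mag Z0 l) * \sum_i N (delta_mx i 0).
have K0 : 0 <= K.
  rewrite mulr_ge0// sumr_ge0// => i _; first exact: zono_mag_ge0.
  exact: is_norm_ge0.
have c0 : 0 <= K / psi by rewrite divr_ge0// ltW.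
exists ((expR 1 + 2) * infnorm A), (2 * (K / psi)) => dt dt0.
set B := _ + _.
have B0 : 0 <= B.
  have := mulr_ge0 (infnorm_ge0 A) (ltW dt0); have := expR_ge0 (1 : R).
  by rewrite /B; nra.
pose P k := `[< sufficient_order A dt N X0 idt Z0 psi k >].
(* The successor of [Num.trunc B] exceeds [B], as [remainder_bound_small] requires with
   [c = K / psi], while [Num.trunc B] itself is at most [B]; the least sufficient order is no
   larger. *)
have PB : P (Num.trunc B).
  have [|e1 rK] := @remainder_bound_small _ _ A dt (K / psi) (Num.trunc B)
    (ltW dt0) c0.
    by rewrite mulrA ltW// truncnS_gt.
  apply/asboolP; split => //; first exact: reach_set_sub_enclosure.
  have r0 := remainder_bound_ge0 (ltW dt0) e1.
  rewrite (le_lt_trans (overapprox_error_le Z0 hN r0))// lte_fin -/K.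
  by move: rK; rewrite mulrA ltr_pdivrMr// mul1r.
case: (ex_minnP (ex_intro P _ PB)) => kappa /asboolP hk hmin.
exists kappa; split => // [k /asboolP|]; first exact: hmin.
by rewrite (le_trans _ (_ : (Num.trunc B)%:R <= B)) ?truncn_le// ler_nat hmin.
Qed.
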